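(* Let $L_1<L_2$ be real numbers and $\nu>0$. Suppose a regular function $\phi=\phi(t,\xi,\eta)$ satisfies $$\begin{aligned} &\phi_t-\nu(2\partial_\xi^2+\partial_\eta^2)\phi=0,\\ &\phi(t,\xi+2\pi,\eta)=\phi(t,\xi,\eta),\quad\forall t\ge0,\ \xi\in\mathbb{R},\ \eta\in(L_1,L_2),\\ &\phi(t,\xi,\eta)\big|_{\eta=L_1}=\phi(t,\xi,\eta)\big|_{\eta=L_2}=0,\quad\forall t\ge0,\ \xi\in\mathbb{R},\\ &\phi(t,\xi,\eta)\big|_{t=0}=\phi_0(\xi,\eta). \end{aligned}$$ Let $$u_{ns}^{pp}(t,x)=\big(-\partial_2\phi(t,x_1+x_2,x_3),\ \partial_1\phi(t,x_1+x_2,x_3),\ 0\big).$$ Then $u=u_{ns}^{pp}$ is a solution of the incompressible Navier-Stokes equations $u_t-\nu\Delta u+(u\cdot\nabla)u+\nabla P=0$, $\nabla\cdot u=0$ in $\mathbb{R}^2\times(L_1,L_2)$ (for some scalar pressure $P$) with boundary condition $$\begin{aligned} &u(t,x_1+2\pi,x_2,x_3)=u(t,x_1,x_2,x_3),\quad\forall t\ge0,\ (x_1,x_2)\in\mathbb{R}^2,\ x_3\in(L_1,L_2),\\ &u(t,x_1,x_2+2\pi,x_3)=u(t,x_1,x_2,x_3),\quad\forall t\ge0,\ (x_1,x_2)\in\mathbb{R}^2,\ x_3\in(L_1,L_2),\\ &u(t,x_1,x_2,x_3)\big|_{x_3=L_1}=u(t,x_1,x_2,x_3)\big|_{x_3=L_2}=0,\quad\forall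 t\ge0,\ (x_1,x_2)\in\mathbb{R}^2, \end{aligned}$$ and initial data $$u(t,x)\big|_{t=0}=\big(-\partial_2\phi_0(x_1+x_2,x_3),\ \partial_1\phi_0(x_1+x_2,x_3),\ 0\big).$$
   Context: Here $x=(x_1,x_2,x_3)$, $\nabla=(\partial_1,\partial_2,\partial_3)$, $\partial_j=\partial/\partial x_j$, and $\partial_j\phi(t,x_1+x_2,x_3)$ denotes the $x_j$-derivative of the composite function $x\mapsto\phi(t,x_1+x_2,x_3)$ (similarly for $\phi_0$). ''Regular'' means sufficiently smooth on $[0,\infty)\times\mathbb{R}\times[L_1,L_2]$, up to $t=0$ and up to the boundary $\eta=L_1,L_2$, for the derivatives and boundary values to make sense classically. *)

(* Defs.v *)
From Stdlib Require Import Reals List.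
From Coquelicot Require Import Coquelicot.
Import ListNotations.

Open Scope R_scope.

(* One-sided at the endpoints of an interval D: only increments staying in D
   are considered.  For D a neighbourhood of x, this is [is_derive f x l]. *)
Definition is_derive_within (D : R -> Prop) (f : R -> R) (x l : R) : Prop :=
  filterdiff f (within D (locally x)) (fun h => scal h l).

(* Derivative of f at p in the direction e, relative to the set Q: the
   variable h ranges over the values for which p + h e lies in Q. *)
Definition is_pderiv {X : NormedModule R_AbsRing} (Q : X -> Prop) (e : X)
    (f : X -> R) (p : X) (l : R) : Prop :=
  is_derive_within (fun h : R => Q (plus p (scal h e)))
                   (fun h : R => f (plus p (scal h e))) 0 l.

Definition ex_pderiv {X : NormedModule R_AbsRing} (Q : X -> Prop) (e : X)
    (f : X -> R) (p : X) : Prop :=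
  exists l : R, is_pderiv Q e f p l.

(* Total operator; like [Derive], meaningful only where [ex_pderiv] holds. *)
Definition pderiv {X : NormedModule R_AbsRing} (Q : X -> Prop) (e : X)
    (f : X -> R) (p : X) : R :=
  iota (is_pderiv Q e f p).

(* All iterated partial derivatives of f (in any order of differentiation)
   with at most k derivatives, each time derivative counting for two, exist on
   Q and are continuous on Q.  Here et is the time direction and es lists the
   space directions.  Every C^k function on Q belongs to this class. *)
Fixpoint regular {X : NormedModule R_AbsRing} (Q : X -> Prop) (et : X)
    (es : list X) (k : nat) (f : X -> R) {struct k} : Prop :=
  continuous_on Q f /\
  match k with
  | O => True
  | S k1 =>
      (forall e : X, In e es ->
         (forall p : X, Q p -> ex_pderiv Q e f p) /\
         regular Q et es k1 (pderiv Q e f)) /\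
      match k1 with
      | O => True
      | S k2 =>
          (forall p : X, Q p -> ex_pderiv Q et f p) /\
          regular Q et es k2 (pderiv Q et f)
      end
  end.

(* Points (t, xi, eta). *)
Definition slab2 (L1 L2 : R) (p : R * R * R) : Prop :=
  let '(t, xi, eta) := p in 0 <= t /\ L1 <= eta <= L2.

Definition dir_t : R * R * R := (1, 0, 0).
Definition dir_xi : R * R * R := (0, 1, 0).
Definition dir_eta : R * R * R := (0, 0, 1).

Definition regular2 (L1 L2 : R) (k : nat) (f : R * R * R -> R) : Prop :=
  regular (slab2 L1 L2) dir_t [dir_xi; dir_eta] k f.

(* phi_t - nu (2 d_xi^2 + d_eta^2) phi *)
Definition heat_operator (L1 L2 nu : R) (phi : R * R * R -> R)
    (p : R * R * R) : R :=
  let D := pderiv (slab2 L1 L2) in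
  D dir_t phi p
  - nu * (2 * D dir_xi (D dir_xi phi) p + D dir_eta (D dir_eta phi) p).

(* Points (t, x1, x2, x3). *)
Definition slab3 (L1 L2 : R) (p : R * R * R * R) : Prop :=
  let '(t, x1, x2, x3) := p in 0 <= t /\ L1 <= x3 <= L2.

Inductive axis : Set := ax1 | ax2 | ax3.

Definition sum_axis (a : axis -> R) : R := a ax1 + a ax2 + a ax3.

Definition dir_time : R * R * R * R := (1, 0, 0, 0).
Definition dir (j : axis) : R * R * R * R :=
  match j with
  | ax1 => (0, 1, 0, 0)
  | ax2 => (0, 0, 1, 0)
  | ax3 => (0, 0, 0, 1)
  end.

Definition regular3 (L1 L2 : R) (k : nat) (f : R * R * R * R -> R) : Prop :=
  regular (slab3 L1 L2) dir_time [dir ax1; dir ax2; dir ax3] k f.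

(* j-th component of u_t - nu Delta u + (u . nabla) u + nabla P *)
Definition momentum (L1 L2 nu : R) (u : axis -> R * R * R * R -> R)
    (P : R * R * R * R -> R) (j : axis) (p : R * R * R * R) : R :=
  let D := pderiv (slab3 L1 L2) in
  D dir_time (u j) p
  - nu * sum_axis (fun i => D (dir i) (D (dir i) (u j)) p)
  + sum_axis (fun i => u i p * D (dir i) (u j) p)
  + D (dir j) P p.

Definition divergence (L1 L2 : R) (u : axis -> R * R * R * R -> R)
    (p : R * R * R * R) : R :=
  sum_axis (fun i => pderiv (slab3 L1 L2) (dir i) (u i) p).

(* Classical solution in R^2 x (L1, L2) for t >= 0 (at t = 0 the time
   derivative is one-sided).  [regular3 _ _ 2] says that u has the derivatives
   occurring in the equations, continuously up to t = 0 and x3 = L1, L2;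
   [regular3 _ _ 1] that P is continuous with a continuous spatial gradient. *)
Definition navier_stokes_solution (L1 L2 nu : R)
    (u : axis -> R * R * R * R -> R) (P : R * R * R * R -> R) : Prop :=
  (forall j, regular3 L1 L2 2 (u j)) /\
  regular3 L1 L2 1 P /\
  (forall t x1 x2 x3, 0 <= t -> L1 < x3 < L2 ->
     (forall j, momentum L1 L2 nu u P j (t, x1, x2, x3) = 0) /\
     divergence L1 L2 u (t, x1, x2, x3) = 0).

(* (- d_2, d_1, 0) applied to the composite (x1, x2, x3) |-> g (x1 + x2) x3 *)
Definition rot_grad (g : R -> R -> R) (j : axis) (x1 x2 x3 : R) : R :=
  match j with
  | ax1 => - Derive (fun y => g (x1 + y) x3) x2
  | ax2 => Derive (fun y => g (y + x2) x3) x1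
  | ax3 => 0
  end.

Definition u_ns_pp (phi : R * R * R -> R) (j : axis) (p : R * R * R * R) : R :=
  let '(t, x1, x2, x3) := p in
  rot_grad (fun xi eta => phi (t, xi, eta)) j x1 x2 x3.

(* Main.v *)
Require Import Defs.
From Stdlib Require Import Reals List Wf_nat Lra Lia.
From Coquelicot Require Import Coquelicot.
Import ListNotations.
Open Scope R_scope.

(** The flow is a shear: with [w] the xi-derivative of [phi] and
    [collapse (t, x1, x2, x3) = (t, x1 + x2, x3)], both x1- and x2-derivatives
    of a function of [collapse] are its xi-derivative, so
    [u = (- w, w, 0) o collapse].  Hence [u . grad] acts on functions of
    [collapse] as [- w d_xi + w d_xi = 0]: the convection term and the
    divergence vanish, and the pressure can be taken to be zero.  The Laplacian
    becomes [2 d_xi^2 + d_eta^2], so that the momentum equation reduces to the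
    heat equation for [w] ([navier_stokes_collapse]).

    The heat equation for [w] is the xi-derivative of the one for [phi]
    ([heat_operator_dxi]).  Commuting d_xi with d_t and d_eta^2 is Schwarz's
    theorem ([pderiv_comm]), available at interior points, that is for
    [0 < t]; the equation extends to [t = 0] because every term of it is
    continuous on the closed slab.

    The remaining work is the calculus of one-sided partial derivatives on the
    slab.  Derivatives there are unique because every direction can be
    approached from within the slab ([slab2_approachable]), and regularity and
    derivatives pull back along the linear map [collapse]
    ([regular_pullback], [pderiv_pullback]).  Periodicity, boundary values and
    initial data hold because [rot_grad] is a multiple of a derivative in xi,
    along which the corresponding identities for [phi] hold
    ([rot_grad_Derive]). *)

(** * One-sided partial derivatives *)

Lemma filterdiff_eps (F : (R -> Prop) -> Prop) (FF : ProperFilter F)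
  (f : R -> R) (x l : R) :
  is_filter_lim F x ->
  filterdiff f F (fun h => scal h l) <->
  forall eps : posreal,
    F (fun y => Rabs (f y - f x - (y - x) * l) <= eps * Rabs (y - x)).
Proof.
  intros Hx; split.
  - intros [_ H] eps; exact (H x Hx eps).
  - intros H; split; [exact (is_linear_scal_l (V := R_NormedModule) l)|].
    intros y Hy eps.
    rewrite <- (is_filter_lim_unique x y Hx Hy).
    exact (H eps).
Qed.

(** The estimate by [eps] avoids the quantification over limit points of the
    filter in [filterdiff], and is the form in which derivatives relative to
    different sets can be compared. *)
Lemma is_derive_within_eps (D : R -> Prop) (f : R -> R) (x l : R) :
  D x ->
  is_derive_within D f x l <->
  forall eps : posreal, locally x (fun y =>
    D y -> Rabs (f y - f x - (y - x) * l) <= eps * Rabs (y - x)).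
Proof.
  intros Dx. unfold is_derive_within.
  assert (FF : ProperFilter (within D (locally x))).
  { split; [|apply within_filter; apply locally_filter].
    intros P [d Hd]. exists x. apply Hd; [apply ball_center|exact Dx]. }
  apply (filterdiff_eps _ FF).
  intros P HP. unfold within. now apply filter_imp with (2 := HP).
Qed.

Lemma is_derive_within_locally (D : R -> Prop) (f : R -> R) (x l : R) :
  locally x D -> is_derive_within D f x l -> is_derive f x l.
Proof.
  intros HD H.
  apply (filterdiff_eps (locally x) _ f x l); [easy|intros eps].
  assert (Dx := locally_singleton _ _ HD).
  generalize (filter_and _ _ HD (proj1 (is_derive_within_eps D f x l Dx) H eps)).
  apply filter_imp; tauto.
Qed.

(** [h = 0] is an accumulation point of the parameters that stay in [Q]: the
    condition under which a derivative relative to [Q] is unique, hence under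
    which [pderiv] means anything. *)
Definition approachable {X : NormedModule R_AbsRing} (Q : X -> Prop) (e p : X)
  : Prop :=
  forall d : posreal, exists h : R,
    h <> 0 /\ Rabs h < d /\ Q (plus p (scal h e)).

Lemma plus_scal_0 {X : NormedModule R_AbsRing} (p e : X) :
  plus p (scal (0 : R) e) = p.
Proof.
  rewrite (scal_zero_l e : scal (0 : R) e = zero). apply plus_zero_r.
Qed.

Lemma plus_scal_shift {X : NormedModule R_AbsRing} (p e : X) (u z : R) :
  plus p (scal z e) = plus (plus p (scal u e)) (scal (z - u) e).
Proof.
  rewrite <- plus_assoc. f_equal.
  replace z with (u + (z - u)) at 1 by ring.
  exact (scal_distr_r u (z - u) e).
Qed.

Lemma is_pderiv_unique {X : NormedModule R_AbsRing} (Q : X -> Prop) (e : X)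
  (f : X -> R) (p : X) (l1 l2 : R) :
  Q p -> approachable Q e p ->
  is_pderiv Q e f p l1 -> is_pderiv Q e f p l2 -> l1 = l2.
Proof.
  intros Qp Happ H1 H2.
  assert (Q0 : Q (plus p (scal (0 : R) e))) by now rewrite plus_scal_0.
  destruct (Req_dec l1 l2) as [|Hne]; [easy|exfalso].
  assert (He : 0 < Rabs (l1 - l2) / 3).
  { assert (0 < Rabs (l1 - l2)) by (apply Rabs_pos_lt; lra). lra. }
  assert (K1 := proj1 (is_derive_within_eps _ _ 0 l1 Q0) H1 (mkposreal _ He)).
  assert (K2 := proj1 (is_derive_within_eps _ _ 0 l2 Q0) H2 (mkposreal _ He)).
  destruct (filter_and _ _ K1 K2) as [d Hd].
  destruct (Happ d) as [h [h0 [hd Qh]]].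
  destruct (Hd h) as [E1 E2].
  { change (Rabs (h - 0) < d). now rewrite Rminus_0_r. }
  specialize (E1 Qh). specialize (E2 Qh). simpl in E1, E2.
  rewrite Rminus_0_r in E1, E2.
  set (a := f (plus p (scal h e)) - f (plus p (scal 0 e))) in *.
  assert (E : Rabs (h * (l1 - l2)) <= 2 * (Rabs (l1 - l2) / 3 * Rabs h)).
  { replace (h * (l1 - l2)) with ((a - h * l2) - (a - h * l1)) by ring.
    eapply Rle_trans; [apply Rabs_triang|]. rewrite Rabs_Ropp. lra. }
  rewrite Rabs_mult in E.
  assert (0 < Rabs h) by (apply Rabs_pos_lt; easy).
  assert (0 < Rabs (l1 - l2)) by (apply Rabs_pos_lt; lra).
  nra.
Qed.

Lemma pderiv_unique {X : NormedModule R_AbsRing} (Q : X -> Prop) (e : X)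
  (f : X -> R) (p : X) (l : R) :
  Q p -> approachable Q e p -> is_pderiv Q e f p l -> pderiv Q e f p = l.
Proof.
  intros Qp Happ H. unfold pderiv.
  apply (iota_unique (V := R_CompleteNormedModule)); [|exact H].
  intros y Hy. exact (is_pderiv_unique Q e f p y l Qp Happ Hy H).
Qed.

(** [iota] selects the derivative only when it is unique, whence the
    approachability. *)
Lemma pderiv_correct {X : NormedModule R_AbsRing} (Q : X -> Prop) (e : X)
  (f : X -> R) (p : X) :
  Q p -> approachable Q e p -> ex_pderiv Q e f p ->
  is_pderiv Q e f p (pderiv Q e f p).
Proof.
  intros Qp Happ [l Hl]. now rewrite (pderiv_unique Q e f p l).
Qed.

(** * Pull-back along a linear map *)

(** A linear map sends the line through [p] in direction [e] to the line
    through [pi p] in direction [pi e], so both difference quotients are the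
    same up to the factor [c].  The factor covers all components of a velocity
    field, including the vanishing one, and the identity [g = c * f o pi] is
    asked on [QX] only because [u_ns_pp] has no such form off the slab. *)
Lemma is_pderiv_pullback {X Y : NormedModule R_AbsRing} (pi : X -> Y)
  (QX : X -> Prop) (QY : Y -> Prop) (e : X) (f : Y -> R) (g : X -> R)
  (c : R) (p : X) (l : R) :
  is_linear pi -> (forall q, QX q <-> QY (pi q)) ->
  (forall q, QX q -> g q = c * f (pi q)) -> QX p ->
  is_pderiv QY (pi e) f (pi p) l -> is_pderiv QX e g p (c * l).
Proof.
  intros Hpi HQ Hg Qp H.
  assert (line : forall h : R,
    pi (plus p (scal h e)) = plus (pi p) (scal h (pi e))).
  { intros h. now rewrite linear_plus, linear_scal. }
  assert (QX0 : QX (plus p (scal (0 : R) e))) by now rewrite plus_scal_0.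
  assert (QY0 : QY (plus (pi p) (scal (0 : R) (pi e)))).
  { rewrite <- line. now apply HQ. }
  apply is_derive_within_eps; [easy|]. intros eps.
  (* The 1 keeps the tolerance defined for c = 0. *)
  assert (Hc : 0 < Rabs c + 1) by (assert (K := Rabs_pos c); lra).
  assert (He : 0 < eps / (Rabs c + 1)).
  { apply Rdiv_lt_0_compat; [apply cond_pos|easy]. }
  generalize (proj1 (is_derive_within_eps _ _ 0 l QY0) H (mkposreal _ He)).
  apply filter_imp. intros h Hh Qh.
  rewrite (Hg _ Qh), (Hg _ QX0), !line.
  assert (QYh : QY (plus (pi p) (scal h (pi e)))) by now rewrite <- line; apply HQ.
  specialize (Hh QYh). simpl in Hh.
  match goal with |- Rabs (c * ?a - c * ?b - ?d * (c * l)) <= _ =>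
    replace (c * a - c * b - d * (c * l)) with (c * (a - b - d * l)) by ring
  end.
  rewrite Rabs_mult.
  apply Rle_trans with ((Rabs c + 1) * (eps / (Rabs c + 1) * Rabs (h - 0))).
  - apply Rmult_le_compat; try apply Rabs_pos; try easy. lra.
  - right. field. lra.
Qed.

Lemma approachable_pullback {X Y : NormedModule R_AbsRing} (pi : X -> Y)
  (QX : X -> Prop) (QY : Y -> Prop) (e p : X) :
  is_linear pi -> (forall q, QX q <-> QY (pi q)) ->
  approachable QY (pi e) (pi p) -> approachable QX e p.
Proof.
  intros Hpi HQ H d. destruct (H d) as [h [h0 [hd Qh]]].
  exists h; repeat split; try easy.
  apply HQ. now rewrite linear_plus, linear_scal.
Qed.

Lemma pderiv_pullback {X Y : NormedModule R_AbsRing} (pi : X -> Y)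
  (QX : X -> Prop) (QY : Y -> Prop) (e : X) (f : Y -> R) (g : X -> R)
  (c : R) (p : X) :
  is_linear pi -> (forall q, QX q <-> QY (pi q)) ->
  (forall q, QX q -> g q = c * f (pi q)) -> QX p ->
  approachable QY (pi e) (pi p) -> ex_pderiv QY (pi e) f (pi p) ->
  ex_pderiv QX e g p /\ pderiv QX e g p = c * pderiv QY (pi e) f (pi p).
Proof.
  intros Hpi HQ Hg Qp Happ Hex.
  assert (H : is_pderiv QX e g p (c * pderiv QY (pi e) f (pi p))).
  { apply (is_pderiv_pullback pi QX QY e f); try easy.
    apply pderiv_correct; try easy. now apply HQ. }
  split; [now eexists; apply H|].
  apply pderiv_unique; try easy.
  now apply (approachable_pullback pi QX QY).
Qed.

Lemma continuous_on_pullback {X Y : NormedModule R_AbsRing} (pi : X -> Y)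
  (QX : X -> Prop) (QY : Y -> Prop) (f : Y -> R) (g : X -> R) (c : R) :
  is_linear pi -> (forall q, QX q <-> QY (pi q)) ->
  (forall q, QX q -> g q = c * f (pi q)) ->
  continuous_on QY f -> continuous_on QX g.
Proof.
  intros Hpi HQ Hg Hf p Qp.
  assert (L : filterlim pi (within QX (locally p)) (within QY (locally (pi p)))).
  { intros P HP. generalize (linear_cont pi p Hpi _ HP).
    unfold filtermap, within. apply filter_imp.
    intros q Hq Qq. now apply Hq, HQ. }
  rewrite (Hg p Qp).
  apply filterlim_within_ext with (f := fun q => scal c (f (pi q))).
  { intros q Qq. now rewrite (Hg q Qq). }
  apply (filterlim_comp _ _ _ (fun q => f (pi q)) (fun y : R => scal c y) _
           (locally (f (pi p)))).
  - apply (filterlim_comp _ _ _ pi f _ _ _ L). now apply Hf, HQ.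
  - apply (filterlim_scal_r (V := R_NormedModule)).
Qed.

(** The relation [g = c * f o pi] on [QX] passes to the derivatives of [f] and
    [g] in corresponding directions, so regularity follows by induction.  The
    induction is complete because a time derivative costs two orders. *)
Lemma regular_pullback {X Y : NormedModule R_AbsRing} (pi : X -> Y)
  (QX : X -> Prop) (QY : Y -> Prop) (etX : X) (esX : list X) (etY : Y)
  (esY : list Y) :
  is_linear pi -> (forall q, QX q <-> QY (pi q)) ->
  pi etX = etY -> (forall e, In e esX -> In (pi e) esY) ->
  (forall e q, In e (etY :: esY) -> QY q -> approachable QY e q) ->
  forall k f g c,
  (forall q, QX q -> g q = c * f (pi q)) ->
  regular QY etY esY k f -> regular QX etX esX k g.
Proof.
  intros Hpi HQ Ht Hs Happ k.
  induction k as [k IH] using lt_wf_ind. intros f g c Hg Hf.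
  assert (D : forall e p, In (pi e) (etY :: esY) ->
    (forall q, QY q -> ex_pderiv QY (pi e) f q) -> QX p ->
    ex_pderiv QX e g p /\ pderiv QX e g p = c * pderiv QY (pi e) f (pi p)).
  { intros e p He Hex Qp.
    assert (QY (pi p)) by now apply HQ.
    apply pderiv_pullback; auto. }
  destruct k as [|k].
  - split; [|easy].
    apply (continuous_on_pullback pi QX QY f g c); try easy. apply Hf.
  - destruct Hf as [Hc [Hsp Hti]].
    split; [now apply (continuous_on_pullback pi QX QY f g c)|].
    split.
    + intros e He. destruct (Hsp (pi e) (Hs e He)) as [Hex Hreg].
      assert (De := fun p => D e p (or_intror (Hs e He)) Hex).
      split; [intros p Qp; now apply De|].
      apply (IH k (Nat.lt_succ_diag_r k) (pderiv QY (pi e) f) _ c); [|easy].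
      intros q Qq. now apply De.
    + destruct k as [|k]; [easy|].
      destruct Hti as [Hex Hreg].
      rewrite <- Ht in Hex, Hreg.
      assert (De := fun p => D etX p (or_introl (eq_sym Ht)) Hex).
      split; [intros p Qp; now apply De|].
      assert (Hk : (k < S (S k))%nat) by lia.
      rewrite Ht in Hreg, De.
      apply (IH k Hk (pderiv QY etY f) _ c); [|easy].
      intros q Qq. now apply De.
Qed.

(** * Partial derivatives at interior points *)

Lemma regular_continuous {X : NormedModule R_AbsRing} (Q : X -> Prop) (et : X)
  (es : list X) (k : nat) (f : X -> R) :
  regular Q et es k f -> continuous_on Q f.
Proof. destruct k; now intros [H _]. Qed.

(** When [Q] contains a whole segment of the line around [q], the relative
    derivative is an ordinary one.  The path [gam] is parametrized with an
    arbitrary origin [u], as needed for derivatives along the coordinate lines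
    of a plane. *)
Lemma is_derive_pderiv {X : NormedModule R_AbsRing} (Q : X -> Prop) (e : X)
  (f : X -> R) (q : X) (gam : R -> X) (u : R) :
  locally (0 : R) (fun h : R => Q (plus q (scal h e))) ->
  ex_pderiv Q e f q ->
  (forall z : R, gam z = plus q (scal (z - u) e)) ->
  is_derive (fun z => f (gam z)) u (pderiv Q e f q).
Proof.
  intros HQ Hex Hgam.
  assert (Qq : Q q) by (rewrite <- (plus_scal_0 q e); exact (locally_singleton _ _ HQ)).
  assert (Happ : approachable Q e q).
  { intros d. destruct HQ as [r Hr].
    assert (Hm : 0 < Rmin d r) by (apply Rmin_pos; apply cond_pos).
    assert (Hmd := Rmin_l d r). assert (Hmr := Rmin_r d r).
    exists (Rmin d r / 2).
    assert (Habs : Rabs (Rmin d r / 2) = Rmin d r / 2) by (apply Rabs_pos_eq; lra).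
    split; [lra|split; [lra|]].
    apply Hr. change (Rabs (Rmin d r / 2 - 0) < r). rewrite Rminus_0_r. lra. }
  assert (H := pderiv_correct Q e f q Qq Happ Hex).
  apply is_derive_within_locally in H; [|exact HQ].
  apply (is_derive_ext (fun z => f (plus q (scal (z - u) e)))).
  { intros z. now rewrite Hgam. }
  replace (pderiv Q e f q) with (scal 1 (pderiv Q e f q))
    by apply (scal_one (pderiv Q e f q)).
  apply (is_derive_comp (fun h : R => f (plus q (scal h e))) (fun z => z - u)).
  - replace (u - u) with 0 by ring. exact H.
  - auto_derive; [easy|ring].
Qed.

Lemma continuous_scal_dir {X : NormedModule R_AbsRing} (e : X) (h : R) :
  continuous (fun z : R => scal z e) h.
Proof. exact (linear_cont _ h (is_linear_scal_l e)). Qed.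

Lemma locally_line {X : NormedModule R_AbsRing} (Q : X -> Prop) (e q : X) :
  locally q Q -> locally (0 : R) (fun h : R => Q (plus q (scal h e))).
Proof.
  intros H.
  assert (C : continuous (fun h : R => plus q (scal h e)) (0 : R)).
  { apply (continuous_plus (fun _ : R => q) (fun h : R => scal h e)).
    - apply continuous_const.
    - apply continuous_scal_dir. }
  apply C. now rewrite plus_scal_0.
Qed.

(** Schwarz's theorem: restrict [f] to the plane through [p] spanned by [e1]
    and [e2], where near the origin the relative derivatives of [f] are
    ordinary partial derivatives of a function of two real variables. *)
Lemma pderiv_comm {X : NormedModule R_AbsRing} (Q : X -> Prop) (e1 e2 : X)
  (f : X -> R) (p : X) :
  (forall q, Q q -> ex_pderiv Q e1 f q) ->
  (forall q, Q q -> ex_pderiv Q e2 f q) ->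
  (forall q, Q q -> ex_pderiv Q e1 (pderiv Q e2 f) q) ->
  (forall q, Q q -> ex_pderiv Q e2 (pderiv Q e1 f) q) ->
  continuous_on Q (pderiv Q e1 (pderiv Q e2 f)) ->
  continuous_on Q (pderiv Q e2 (pderiv Q e1 f)) ->
  locally p Q ->
  pderiv Q e1 (pderiv Q e2 f) p = pderiv Q e2 (pderiv Q e1 f) p.
Proof.
  intros D1 D2 D12 D21 C12 C21 Hp.
  set (s := fun u v : R => plus (plus p (scal u e1)) (scal v e2)).
  assert (s1 : forall v u z : R, s z v = plus (s u v) (scal (z - u) e1)).
  { intros v u z. unfold s. rewrite (plus_scal_shift p e1 u z).
    rewrite <- !(plus_assoc (plus p (scal u e1))). f_equal. apply plus_comm. }
  assert (s2 : forall u v z : R, s u z = plus (s u v) (scal (z - v) e2)).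
  { intros u v z. apply plus_scal_shift. }
  assert (s00 : s 0 0 = p) by (unfold s; now rewrite !plus_scal_0).
  assert (Cs : continuous (fun z : R * R => s (fst z) (snd z)) (0, 0)).
  { unfold s.
    apply (continuous_plus (fun z : R * R => plus p (scal (fst z) e1))
             (fun z : R * R => scal (snd z) e2)).
    - apply (continuous_plus (fun z : R * R => p)
             (fun z : R * R => scal (fst z) e1)); [apply continuous_const|].
      apply (continuous_comp (fst : R * R -> R) (fun a : R => scal a e1)).
      + apply continuous_fst.
      + apply continuous_scal_dir.
    - apply (continuous_comp (snd : R * R -> R) (fun a : R => scal a e2)).
      + apply continuous_snd.
      + apply continuous_scal_dir. }
  (* Interior points of Q, rather than points of Q: this set is open, which is
     needed to differentiate a derivative. *)
  set (N := fun u v : R => locally (s u v) Q).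
  assert (HN : locally_2d N 0 0).
  { apply locally_2d_locally. apply (Cs (fun q => locally q Q)).
    simpl. rewrite s00. now apply locally_locally. }
  assert (NQ : forall u v, N u v -> Q (s u v)).
  { intros u v. apply locally_singleton. }
  assert (d1 : forall (h : X -> R) u v, N u v -> ex_pderiv Q e1 h (s u v) ->
    is_derive (fun z => h (s z v)) u (pderiv Q e1 h (s u v))).
  { intros h u v Huv Hh.
    apply (is_derive_pderiv Q e1 h (s u v) (fun z => s z v)); auto.
    now apply locally_line. }
  assert (d2 : forall (h : X -> R) u v, N u v -> ex_pderiv Q e2 h (s u v) ->
    is_derive (fun z => h (s u z)) v (pderiv Q e2 h (s u v))).
  { intros h u v Huv Hh.
    apply (is_derive_pderiv Q e2 h (s u v) (fun z => s u z)); auto.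
    now apply locally_line. }
  assert (N1 : forall u v, N u v -> locally u (fun z => N z v)).
  { intros u v Huv. apply locally_locally in Huv.
    generalize (locally_line (fun q => locally q Q) e1 _ Huv).
    intros [d Hd]. exists d. intros z Hz.
    unfold N. rewrite (s1 v u z). apply Hd.
    change (Rabs (z - u - 0) < d). rewrite Rminus_0_r. exact Hz. }
  assert (N2 : forall u v, N u v -> locally v (fun z => N u z)).
  { intros u v Huv. apply locally_locally in Huv.
    generalize (locally_line (fun q => locally q Q) e2 _ Huv).
    intros [d Hd]. exists d. intros z Hz.
    unfold N. rewrite (s2 u v z). apply Hd.
    change (Rabs (z - v - 0) < d). rewrite Rminus_0_r. exact Hz. }
  assert (d12 : forall u v, N u v ->
    is_derive (fun z => Derive (fun t => f (s z t)) v) u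
      (pderiv Q e1 (pderiv Q e2 f) (s u v))).
  { intros u v Huv.
    apply (is_derive_ext_loc (fun z => pderiv Q e2 f (s z v))); auto.
    generalize (N1 u v Huv). apply filter_imp. intros z Hz.
    symmetry. apply is_derive_unique; auto. }
  assert (d21 : forall u v, N u v ->
    is_derive (fun z => Derive (fun t => f (s t z)) u) v
      (pderiv Q e2 (pderiv Q e1 f) (s u v))).
  { intros u v Huv.
    apply (is_derive_ext_loc (fun z => pderiv Q e1 f (s u z))); auto.
    generalize (N2 u v Huv). apply filter_imp. intros z Hz.
    symmetry. apply is_derive_unique; auto. }
  assert (N0 : N 0 0) by (unfold N; now rewrite s00).
  assert (cont : forall (G : X -> R) (g : R -> R -> R), continuous_on Q G ->
    (forall u v, N u v -> g u v = G (s u v)) -> continuity_2d_pt g 0 0).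
  { intros G g HG Hg.
    apply continuity_2d_pt_ext_loc with (f := fun u v => G (s u v)).
    { revert HN. apply locally_2d_impl, locally_2d_forall.
      intros u v Huv. symmetry. auto. }
    apply continuity_2d_pt_filterlim.
    apply (filterlim_comp _ _ _ (fun z : R * R => s (fst z) (snd z)) G _
             (locally (s 0 0))); [exact Cs|].
    intros P HP. generalize (filter_and _ _ N0 (HG _ (NQ _ _ N0) P HP)).
    unfold filtermap, within. apply filter_imp. intuition. }
  assert (S := Schwarz (fun u v => f (s u v)) 0 0).
  rewrite <- s00.
  rewrite <- (is_derive_unique _ _ _ (d12 0 0 N0)).
  rewrite <- (is_derive_unique _ _ _ (d21 0 0 N0)).
  apply S.
  - revert HN. apply locally_2d_impl, locally_2d_forall. intros u v Huv.
    repeat split; eexists; eauto.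
  - apply (cont (pderiv Q e1 (pderiv Q e2 f))); [easy|].
    intros u v Huv. apply is_derive_unique; auto.
  - apply (cont (pderiv Q e2 (pderiv Q e1 f))); [easy|].
    intros u v Huv. apply is_derive_unique; auto.
Qed.

Lemma pderiv_ext_interior {X : NormedModule R_AbsRing} (Q : X -> Prop) (e : X)
  (f g : X -> R) (p : X) :
  locally p Q -> locally p (fun q => f q = g q) ->
  ex_pderiv Q e f p -> ex_pderiv Q e g p ->
  pderiv Q e f p = pderiv Q e g p.
Proof.
  intros Hp Hfg Hf Hg.
  set (gam := fun z : R => plus p (scal z e)).
  assert (Hgam : forall z : R, gam z = plus p (scal (z - 0) e)).
  { intros z. now rewrite Rminus_0_r. }
  assert (HQ := locally_line Q e p Hp).
  rewrite <- (is_derive_unique _ _ _ (is_derive_pderiv Q e f p gam 0 HQ Hf Hgam)).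
  rewrite <- (is_derive_unique _ _ _ (is_derive_pderiv Q e g p gam 0 HQ Hg Hgam)).
  apply Derive_ext_loc. exact (locally_line _ e p Hfg).
Qed.

(** * The heat equation for the xi-derivative *)

Lemma slab2_interior (L1 L2 t xi eta : R) :
  0 < t -> L1 < eta < L2 ->
  locally ((t, xi, eta) : R * R * R) (fun q => let '(s, _, y) := q in
    0 < s /\ L1 < y < L2).
Proof.
  intros Ht He.
  assert (Hd : 0 < Rmin t (Rmin (eta - L1) (L2 - eta))).
  { repeat apply Rmin_pos; lra. }
  exists (mkposreal _ Hd). intros [[s x] y] [[Hs _] Hy].
  change (Rabs (s - t) < Rmin t (Rmin (eta - L1) (L2 - eta))) in Hs.
  change (Rabs (y - eta) < Rmin t (Rmin (eta - L1) (L2 - eta))) in Hy.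
  assert (A := Rmin_l t (Rmin (eta - L1) (L2 - eta))).
  assert (B := Rmin_r t (Rmin (eta - L1) (L2 - eta))).
  assert (C := Rmin_l (eta - L1) (L2 - eta)).
  assert (D := Rmin_r (eta - L1) (L2 - eta)).
  apply Rabs_def2 in Hs. apply Rabs_def2 in Hy. lra.
Qed.

(** Time is approached from later times; in the direction eta one moves towards
    the middle of the interval, which has positive length. *)
Lemma slab2_approachable (L1 L2 : R) (e q : R * R * R) :
  L1 < L2 -> In e [dir_t; dir_xi; dir_eta] -> slab2 L1 L2 q ->
  approachable (slab2 L1 L2) e q.
Proof.
  intros hL He Hq d. destruct q as [[t xi] eta]. destruct Hq as [Ht Heta].
  assert (Hd := cond_pos d).
  assert (P : forall h : R, plus ((t, xi, eta) : R * R * R) (scal h e) =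
    (t + h * fst (fst e), xi + h * snd (fst e), eta + h * snd e)).
  { intros h. now destruct e as [[e1 e2] e3]. }
  assert (Habs : forall x : R, 0 < x -> Rabs x = x /\ Rabs (- x) = x).
  { intros x Hx. rewrite Rabs_Ropp. split; apply Rabs_pos_eq; lra. }
  destruct He as [<-|[<-|[<-|[]]]].
  - exists (d / 2). rewrite P. destruct (Habs (d / 2)); [lra|]. unfold slab2; simpl. lra.
  - exists (d / 2). rewrite P. destruct (Habs (d / 2)); [lra|]. unfold slab2; simpl. lra.
  (* Starting in one half of [L1, L2], a step of at most half its length
     towards the other half stays inside. *)
  - set (m := Rmin (d / 2) ((L2 - L1) / 2)).
    assert (Hm : 0 < m) by (apply Rmin_pos; lra).
    assert (A := Rmin_l (d / 2) ((L2 - L1) / 2)).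
    assert (B := Rmin_r (d / 2) ((L2 - L1) / 2)).
    fold m in A, B. destruct (Habs m Hm) as [E1 E2].
    destruct (Rle_dec eta ((L1 + L2) / 2)).
    + exists m. rewrite P. unfold slab2; simpl. lra.
    + exists (- m). rewrite P. unfold slab2; simpl. lra.
Qed.

Lemma continuous_on_plus_scal {X : NormedModule R_AbsRing} (Q : X -> Prop)
  (f g : X -> R) (a : R) :
  continuous_on Q f -> continuous_on Q g ->
  continuous_on Q (fun p => f p + a * g p).
Proof.
  intros Hf Hg p Qp.
  apply (filterlim_comp_2 (G := locally (f p)) (H := locally (a * g p))
    f (fun q => a * g q) Rplus).
  - now apply Hf.
  - apply (filterlim_comp _ _ _ g (fun y => a * y) _ (locally (g p))).
    + now apply Hg.
    + apply (filterlim_scal_r (V := R_NormedModule)).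
  - apply (filterlim_plus (V := R_NormedModule)).
Qed.

Lemma heat_operator_continuous (L1 L2 nu : R) (w : R * R * R -> R) :
  regular2 L1 L2 2 w -> continuous_on (slab2 L1 L2) (heat_operator L1 L2 nu w).
Proof.
  intros [_ [Hs [_ Ht]]].
  assert (C : forall e, In e [dir_xi; dir_eta] -> continuous_on (slab2 L1 L2)
    (pderiv (slab2 L1 L2) e (pderiv (slab2 L1 L2) e w))).
  { intros e He. destruct (Hs e He) as [_ [_ [H _]]].
    now apply (regular_continuous _ dir_t [dir_xi; dir_eta] 0), H. }
  assert (Cx := C dir_xi (or_introl eq_refl)).
  assert (Ce := C dir_eta (or_intror (or_introl eq_refl))).
  apply regular_continuous in Ht.
  assert (K := continuous_on_plus_scal _ _ _ (- nu)
    (continuous_on_plus_scal _ _ _ (- (2 * nu)) Ht Cx) Ce).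
  match type of K with continuous_on _ ?F =>
    assert (E : forall q, F q = heat_operator L1 L2 nu w q)
  end.
  { intros q. unfold heat_operator. simpl. ring. }
  intros p Qp. rewrite <- E. exact (filterlim_ext _ _ E (K p Qp)).
Qed.

(** Differentiate the equation for [phi] along the xi-line: the heat operator
    of [phi] vanishes near the point, so its xi-derivative does.  All mixed
    derivatives exchanged here have parabolic order at most three. *)
Lemma heat_operator_dxi_interior (L1 L2 nu : R) (phi : R * R * R -> R)
  (t xi eta : R) :
  regular2 L1 L2 3 phi ->
  (forall t xi eta, 0 < t -> L1 < eta < L2 ->
     heat_operator L1 L2 nu phi (t, xi, eta) = 0) ->
  0 < t -> L1 < eta < L2 ->
  heat_operator L1 L2 nu (pderiv (slab2 L1 L2) dir_xi phi) (t, xi, eta) = 0.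
Proof.
  intros Hreg Hheat Ht He.
  destruct Hreg as [_ [Hs [Et [_ [Hst _]]]]].
  set (Q := slab2 L1 L2) in *.
  set (p := (t, xi, eta)).
  assert (HI := slab2_interior L1 L2 t xi eta Ht He). fold p in HI.
  assert (IQ : forall q : R * R * R,
    (let '(s, _, y) := q in 0 < s /\ L1 < y < L2) -> Q q).
  { intros [[s x] y]. unfold Q; simpl. lra. }
  assert (HQ : locally p Q) by (revert HI; apply filter_imp, IQ).
  assert (HQ' := locally_locally p Q HQ).
  destruct (Hs dir_xi) as [Ex [_ [Hsx [Etx Rtx]]]]; [simpl; tauto|].
  destruct (Hs dir_eta) as [Ee [_ [Hse _]]]; [simpl; tauto|].
  destruct (Hst dir_xi) as [Ext Rxt]; [simpl; tauto|].
  destruct (Hsx dir_xi) as [Exx [_ [Hsxx _]]]; [simpl; tauto|].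
  destruct (Hsx dir_eta) as [Eex [Rex [Hsex _]]]; [simpl; tauto|].
  destruct (Hse dir_eta) as [Eee [_ [Hsee _]]]; [simpl; tauto|].
  destruct (Hse dir_xi) as [Exe [Rxe [Hsxe _]]]; [simpl; tauto|].
  destruct (Hsxx dir_xi) as [Exxx _]; [simpl; tauto|].
  destruct (Hsex dir_eta) as [Eeex _]; [simpl; tauto|].
  destruct (Hsxe dir_eta) as [Eexe Rexe]; [simpl; tauto|].
  destruct (Hsee dir_xi) as [Exee Rxee]; [simpl; tauto|].
  assert (A1 : pderiv Q dir_t (pderiv Q dir_xi phi) p
    = pderiv Q dir_xi (pderiv Q dir_t phi) p).
  { exact (pderiv_comm Q dir_t dir_xi phi p Et Ex Etx Ext
      (regular_continuous _ _ _ _ _ Rtx) (regular_continuous _ _ _ _ _ Rxt) HQ). }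
  assert (A2 : forall q, locally q Q -> pderiv Q dir_eta (pderiv Q dir_xi phi) q
    = pderiv Q dir_xi (pderiv Q dir_eta phi) q).
  { intros q Hq.
    exact (pderiv_comm Q dir_eta dir_xi phi q Ee Ex Eex Exe Rex Rxe Hq). }
  assert (Qp := locally_singleton _ _ HQ).
  (* d_xi moves past one d_eta at a time; the first exchange must hold in a
     neighbourhood, since the other d_eta is still to be taken. *)
  assert (A3 : pderiv Q dir_eta (pderiv Q dir_eta (pderiv Q dir_xi phi)) p
    = pderiv Q dir_xi (pderiv Q dir_eta (pderiv Q dir_eta phi)) p).
  { transitivity (pderiv Q dir_eta (pderiv Q dir_xi (pderiv Q dir_eta phi)) p).
    - exact (pderiv_ext_interior Q dir_eta _ _ p HQ
        (filter_imp _ _ A2 HQ') (Eeex p Qp) (Eexe p Qp)).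
    - exact (pderiv_comm Q dir_eta dir_xi (pderiv Q dir_eta phi) p Eee Exe Eexe
        Exee (regular_continuous _ _ _ _ _ Rexe)
        (regular_continuous _ _ _ _ _ Rxee) HQ). }
  unfold heat_operator. fold Q.
  rewrite A1, A3.
  set (gam := fun z : R => plus (p : prod_NormedModule R_AbsRing
    (prod_NormedModule R_AbsRing R_NormedModule R_NormedModule) R_NormedModule)
    (scal z dir_xi)).
  assert (Hgam : forall z : R, gam z = plus p (scal (z - 0) dir_xi)).
  { intros z. now rewrite Rminus_0_r. }
  assert (HL := locally_line Q dir_xi p HQ).
  assert (D1 := is_derive_pderiv Q dir_xi _ p gam 0 HL (Ext p Qp) Hgam).
  assert (D2 := is_derive_pderiv Q dir_xi _ p gam 0 HL (Exxx p Qp) Hgam).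
  assert (D3 := is_derive_pderiv Q dir_xi _ p gam 0 HL (Exee p Qp) Hgam).
  assert (D : is_derive (fun z => heat_operator L1 L2 nu phi (gam z)) 0
   (pderiv Q dir_xi (pderiv Q dir_t phi) p
    - nu * (2 * pderiv Q dir_xi (pderiv Q dir_xi (pderiv Q dir_xi phi)) p
            + pderiv Q dir_xi (pderiv Q dir_eta (pderiv Q dir_eta phi)) p))).
  { unfold heat_operator.
    apply (is_derive_minus (V := R_NormedModule)); [exact D1|].
    apply (is_derive_scal (fun z => 2 * _ + _)).
    apply (is_derive_plus (V := R_NormedModule)); [|exact D3].
    apply is_derive_scal. exact D2. }
  rewrite <- (is_derive_unique _ _ _ D).
  transitivity (Derive (fun _ => 0) 0); [|apply Derive_const].
  apply Derive_ext_loc.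
  assert (HL' := locally_line _ dir_xi p HI).
  revert HL'. apply filter_imp. intros z.
  unfold gam. destruct (plus p (scal z dir_xi)) as [[s x] y].
  intros [Hs' Hy]. now apply Hheat.
Qed.

(** At [t = 0] the equation for [phi] is not assumed, so the identity is
    obtained as the limit of those at later times. *)
Lemma heat_operator_dxi (L1 L2 nu : R) (phi : R * R * R -> R) (t xi eta : R) :
  regular2 L1 L2 3 phi ->
  (forall t xi eta, 0 < t -> L1 < eta < L2 ->
     heat_operator L1 L2 nu phi (t, xi, eta) = 0) ->
  0 <= t -> L1 < eta < L2 ->
  heat_operator L1 L2 nu (pderiv (slab2 L1 L2) dir_xi phi) (t, xi, eta) = 0.
Proof.
  intros Hreg Hheat Ht He.
  set (H := heat_operator L1 L2 nu (pderiv (slab2 L1 L2) dir_xi phi)).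
  assert (HC : continuous_on (slab2 L1 L2) H).
  { apply heat_operator_continuous.
    destruct Hreg as [_ [Hs _]]. apply (Hs dir_xi). simpl; tauto. }
  assert (Qp : slab2 L1 L2 (t, xi, eta)) by (unfold slab2; lra).
  assert (L : filterlim (fun s : R => (s, xi, eta)) (at_right t)
    (within (slab2 L1 L2) (locally (t, xi, eta)))).
  { intros P [d Hd]. exists d. intros s Hs Hts.
    apply Hd.
    - split; [split|]; [exact Hs|apply ball_center|apply ball_center].
    - unfold slab2; lra. }
  apply (filterlim_locally_unique (F := at_right t) (fun s => H (s, xi, eta))).
  - exact (filterlim_comp _ _ _ _ _ _ _ _ L (HC _ Qp)).
  - apply filterlim_ext_loc with (f := fun _ => 0).
    + exists (mkposreal 1 Rlt_0_1). intros s _ Hs.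
      symmetry. apply heat_operator_dxi_interior; auto. lra.
    + apply filterlim_const.
Qed.

(** * Flows depending on x1 + x2 only *)

Definition collapse (p : R * R * R * R) : R * R * R :=
  let '(t, x1, x2, x3) := p in (t, x1 + x2, x3).

Lemma collapse_linear : is_linear collapse.
Proof.
  apply (is_linear_ext (fun p : R * R * R * R =>
    (fst (fst (fst p)), plus (snd (fst (fst p))) (snd (fst p)), snd p))).
  { now intros [[[t x1] x2] x3]. }
  assert (F1 : is_linear (fun p : R * R * R * R => fst p)) by apply is_linear_fst.
  assert (F2 : is_linear (fun p : R * R * R => fst p)) by apply is_linear_fst.
  assert (F3 : is_linear (fun p : R * R => fst p)) by apply is_linear_fst.
  assert (S1 : is_linear (fun p : R * R * R * R => snd p)) by apply is_linear_snd.
  assert (S2 : is_linear (fun p : R * R * R => snd p)) by apply is_linear_snd.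
  assert (S3 : is_linear (fun p : R * R => snd p)) by apply is_linear_snd.
  assert (F12 := is_linear_comp _ _ F1 F2).
  apply (is_linear_prod (fun p : R * R * R * R =>
    (fst (fst (fst p)), plus (snd (fst (fst p))) (snd (fst p))))); [|exact S1].
  apply is_linear_prod.
  - exact (is_linear_comp _ _ F12 F3).
  - apply (is_linear_comp (fun p : R * R * R * R => (snd (fst (fst p)), snd (fst p)))
      (fun z : R * R => plus (fst z) (snd z))); [|exact (is_linear_plus (V := R_NormedModule))].
    apply is_linear_prod.
    + exact (is_linear_comp _ _ F12 S3).
    + exact (is_linear_comp _ _ F1 S2).
Qed.

Lemma slab3_collapse (L1 L2 : R) (p : R * R * R * R) :
  slab3 L1 L2 p <-> slab2 L1 L2 (collapse p).
Proof. now destruct p as [[[t x1] x2] x3]. Qed.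

Lemma collapse_dir_time : collapse dir_time = dir_t.
Proof. unfold collapse, dir_time, dir_t. now rewrite Rplus_0_l. Qed.

Lemma collapse_dir (j : axis) :
  collapse (dir j) = match j with ax3 => dir_eta | _ => dir_xi end.
Proof.
  destruct j; unfold collapse, dir, dir_xi, dir_eta; repeat f_equal; ring.
Qed.

Definition amplitude (j : axis) : R :=
  match j with ax1 => -1 | ax2 => 1 | ax3 => 0 end.

Lemma regular3_collapse (L1 L2 : R) (k : nat) (f : R * R * R -> R)
  (g : R * R * R * R -> R) (c : R) :
  L1 < L2 -> (forall p, slab3 L1 L2 p -> g p = c * f (collapse p)) ->
  regular2 L1 L2 k f -> regular3 L1 L2 k g.
Proof.
  intros hL Hg.
  apply (regular_pullback collapse (slab3 L1 L2) (slab2 L1 L2) dir_time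
    [dir ax1; dir ax2; dir ax3] dir_t [dir_xi; dir_eta]) with (c := c).
  - exact collapse_linear.
  - apply slab3_collapse.
  - exact collapse_dir_time.
  - intros e [<-|[<-|[<-|[]]]]; rewrite collapse_dir; simpl; tauto.
  - intros e q He Qq. now apply slab2_approachable.
  - exact Hg.
Qed.

Lemma pderiv_collapse (L1 L2 : R) (e : R * R * R * R) (e' : R * R * R)
  (f : R * R * R -> R) (g : R * R * R * R -> R) (c : R) (p : R * R * R * R) :
  L1 < L2 -> (forall q, slab3 L1 L2 q -> g q = c * f (collapse q)) ->
  collapse e = e' -> In e' [dir_t; dir_xi; dir_eta] ->
  (forall q, slab2 L1 L2 q -> ex_pderiv (slab2 L1 L2) e' f q) ->
  slab3 L1 L2 p ->
  pderiv (slab3 L1 L2) e g p = c * pderiv (slab2 L1 L2) e' f (collapse p).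
Proof.
  intros hL Hg <- He Hex Qp.
  assert (slab2 L1 L2 (collapse p)) by now apply slab3_collapse.
  apply (pderiv_pullback collapse); auto.
  - exact collapse_linear.
  - apply slab3_collapse.
  - now apply slab2_approachable.
Qed.

(** Since [amplitude ax1 + amplitude ax2 = 0] and the x1- and x2-derivatives
    coincide, divergence and convection cancel; the momentum equation is
    [amplitude j] times the heat equation for [w], where the factor 2 counts
    the two directions that [collapse] sends to xi. *)
Lemma navier_stokes_collapse (L1 L2 nu : R) (w : R * R * R -> R)
  (u : axis -> R * R * R * R -> R) :
  L1 < L2 -> regular2 L1 L2 2 w ->
  (forall t xi eta, 0 <= t -> L1 < eta < L2 ->
     heat_operator L1 L2 nu w (t, xi, eta) = 0) ->
  (forall j p, slab3 L1 L2 p -> u j p = amplitude j * w (collapse p)) ->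
  navier_stokes_solution L1 L2 nu u (fun _ => 0).
Proof.
  intros hL Hw Hheat Hu.
  assert (Hsp : forall e, In e [dir_xi; dir_eta] ->
    (forall q, slab2 L1 L2 q -> ex_pderiv (slab2 L1 L2) e w q) /\
    regular2 L1 L2 1 (pderiv (slab2 L1 L2) e w)) by apply Hw.
  split; [|split].
  - intros j. exact (regular3_collapse L1 L2 2 w (u j) (amplitude j) hL (Hu j) Hw).
  (* The zero pressure is 0 times any function of parabolic order 1; the
     xi-derivative of w is one. *)
  - apply (regular3_collapse L1 L2 1 (pderiv (slab2 L1 L2) dir_xi w) _ 0); auto.
    + intros p _. ring.
    + apply Hsp. simpl; tauto.
  - intros t x1 x2 x3 Ht Hx. set (p := (t, x1, x2, x3)).
    assert (Qp : slab3 L1 L2 p) by (unfold p, slab3; lra).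
    set (d := fun i => match i with ax3 => dir_eta | _ => dir_xi end).
    assert (Hd : forall i, In (d i) [dir_xi; dir_eta]).
    { intros []; simpl; tauto. }
    set (Q2 := slab2 L1 L2).
    assert (Dt : forall j, pderiv (slab3 L1 L2) dir_time (u j) p
      = amplitude j * pderiv Q2 dir_t w (collapse p)).
    { intros j. apply pderiv_collapse; auto.
      - exact collapse_dir_time.
      - simpl; tauto.
      - apply Hw. }
    assert (D1 : forall i j q, slab3 L1 L2 q ->
      pderiv (slab3 L1 L2) (dir i) (u j) q
      = amplitude j * pderiv Q2 (d i) w (collapse q)).
    { intros i j q Qq. apply pderiv_collapse; auto.
      - apply collapse_dir.
      - right. apply Hd.
      - exact (proj1 (Hsp (d i) (Hd i))). }
    assert (D2 : forall i j,
      pderiv (slab3 L1 L2) (dir i) (pderiv (slab3 L1 L2) (dir i) (u j)) p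
      = amplitude j * pderiv Q2 (d i) (pderiv Q2 (d i) w) (collapse p)).
    { intros i j. apply pderiv_collapse; auto.
      - apply collapse_dir.
      - right. apply Hd.
      - destruct (Hsp (d i) (Hd i)) as [_ [_ [H _]]]. exact (proj1 (H (d i) (Hd i))). }
    assert (DP : forall j, pderiv (slab3 L1 L2) (dir j) (fun _ => 0) p = 0).
    { intros j. rewrite <- (Rmult_0_l (pderiv Q2 (d j) w (collapse p))).
      apply pderiv_collapse; auto.
      - intros q _. ring.
      - apply collapse_dir.
      - right. apply Hd.
      - exact (proj1 (Hsp (d j) (Hd j))). }
    assert (HH : heat_operator L1 L2 nu w (collapse p) = 0) by now apply Hheat.
    unfold heat_operator in HH. fold Q2 in HH.
    split.
    + intros j. unfold momentum, sum_axis.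
      rewrite Dt, !D2, !D1, DP, !Hu; try exact Qp. unfold d.
      set (a := pderiv Q2 dir_t w (collapse p)) in *.
      set (b := pderiv Q2 dir_xi (pderiv Q2 dir_xi w) (collapse p)) in *.
      set (c := pderiv Q2 dir_eta (pderiv Q2 dir_eta w) (collapse p)) in *.
      transitivity (amplitude j * (a - nu * (2 * b + c))).
      * simpl amplitude. ring.
      * rewrite HH. ring.
    + unfold divergence, sum_axis. rewrite !D1; try exact Qp.
      unfold d. simpl amplitude. ring.
Qed.

(** Unconditional, even where [g] is not differentiable: both sides are limits
    of the same difference quotients. *)
Lemma rot_grad_Derive (g : R -> R -> R) (j : axis) (x1 x2 x3 : R) :
  rot_grad g j x1 x2 x3
  = amplitude j * Derive (fun z => g z x3) (x1 + x2).
Proof.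
  assert (A : Derive (fun y => g (x1 + y) x3) x2
    = Derive (fun z => g z x3) (x1 + x2)).
  { unfold Derive. f_equal. apply Lim_ext. intros h. now rewrite Rplus_assoc. }
  assert (B : Derive (fun y => g (y + x2) x3) x1
    = Derive (fun z => g z x3) (x1 + x2)).
  { unfold Derive. f_equal. apply Lim_ext. intros h.
    replace (x1 + h + x2) with (x1 + x2 + h) by ring. easy. }
  destruct j; simpl; rewrite ?A, ?B; ring.
Qed.

(** The slab contains every xi-line through its points, so at all of them,
    including the boundary and [t = 0], the relative xi-derivative of [phi] is
    the two-sided one in [rot_grad]. *)
Lemma u_ns_pp_collapse (L1 L2 : R) (phi : R * R * R -> R) (j : axis)
  (p : R * R * R * R) :
  regular2 L1 L2 3 phi -> slab3 L1 L2 p ->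
  u_ns_pp phi j p
  = amplitude j * pderiv (slab2 L1 L2) dir_xi phi (collapse p).
Proof.
  destruct p as [[[t x1] x2] x3]. intros [_ [Hs _]] Qp.
  unfold u_ns_pp. rewrite rot_grad_Derive. f_equal.
  apply is_derive_unique.
  assert (line : forall h : R,
    plus ((t, x1 + x2, x3) : R * R * R) (scal h dir_xi) = (t, x1 + x2 + h, x3)).
  { intros h. unfold dir_xi.
    change ((t + h * 0, x1 + x2 + h * 1, x3 + h * 0) = (t, x1 + x2 + h, x3)).
    repeat f_equal; ring. }
  apply (is_derive_pderiv (slab2 L1 L2) dir_xi phi (t, x1 + x2, x3)
    (fun z => (t, z, x3))).
  - apply filter_forall. intros h. rewrite line. exact Qp.
  - exact (proj1 (Hs dir_xi (or_introl eq_refl)) (t, x1 + x2, x3) Qp).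
  - intros z. now rewrite line, Rplus_minus.
Qed.

Theorem theorem1p8 (L1 L2 nu : R) (phi : R * R * R -> R) (phi0 : R -> R -> R)
  (hL : L1 < L2) (hnu : 0 < nu)
  (phi_regular : regular2 L1 L2 3 phi)
  (phi_heat : forall t xi eta, 0 < t -> L1 < eta < L2 ->
     heat_operator L1 L2 nu phi (t, xi, eta) = 0)
  (phi_periodic : forall t xi eta, 0 <= t -> L1 < eta < L2 ->
     phi (t, xi + 2 * PI, eta) = phi (t, xi, eta))
  (phi_boundary : forall t xi, 0 <= t ->
     phi (t, xi, L1) = 0 /\ phi (t, xi, L2) = 0)
  (phi_initial : forall xi eta, L1 <= eta <= L2 ->
     phi (0, xi, eta) = phi0 xi eta) :
  let u := u_ns_pp phi in
  (exists P : R * R * R * R -> R, navier_stokes_solution L1 L2 nu u P) /\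
  (forall j t x1 x2 x3, 0 <= t -> L1 < x3 < L2 ->
     u j (t, x1 + 2 * PI, x2, x3) = u j (t, x1, x2, x3)) /\
  (forall j t x1 x2 x3, 0 <= t -> L1 < x3 < L2 ->
     u j (t, x1, x2 + 2 * PI, x3) = u j (t, x1, x2, x3)) /\
  (forall j t x1 x2, 0 <= t ->
     u j (t, x1, x2, L1) = 0 /\ u j (t, x1, x2, L2) = 0) /\
  (forall j x1 x2 x3, L1 <= x3 <= L2 ->
     u j (0, x1, x2, x3) = rot_grad phi0 j x1 x2 x3).
Proof.
  intros u.
  assert (periodic : forall t xi eta, 0 <= t -> L1 < eta < L2 ->
    Derive (fun z => phi (t, z, eta)) (xi + 2 * PI)
    = Derive (fun z => phi (t, z, eta)) xi).
  { intros t xi eta Ht He. unfold Derive. f_equal. apply Lim_ext. intros h.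
    replace (xi + 2 * PI + h) with (xi + h + 2 * PI) by ring.
    now rewrite !phi_periodic. }
  repeat split.
  - exists (fun _ => 0).
    apply (navier_stokes_collapse L1 L2 nu (pderiv (slab2 L1 L2) dir_xi phi)).
    + exact hL.
    + destruct phi_regular as [_ [Hs _]]. apply (Hs dir_xi). simpl; tauto.
    + intros t xi eta. now apply heat_operator_dxi.
    + intros j p. now apply u_ns_pp_collapse.
  - intros j t x1 x2 x3 Ht Hx. unfold u, u_ns_pp. rewrite !rot_grad_Derive.
    replace (x1 + 2 * PI + x2) with (x1 + x2 + 2 * PI) by ring.
    now rewrite periodic.
  - intros j t x1 x2 x3 Ht Hx. unfold u, u_ns_pp. rewrite !rot_grad_Derive.
    rewrite <- Rplus_assoc. now rewrite periodic.
  - unfold u, u_ns_pp. rewrite rot_grad_Derive.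
    rewrite (Derive_ext _ (fun _ => 0)); [rewrite Derive_const; ring|].
    intros z. now apply phi_boundary.
  - unfold u, u_ns_pp. rewrite rot_grad_Derive.
    rewrite (Derive_ext _ (fun _ => 0)); [rewrite Derive_const; ring|].
    intros z. now apply phi_boundary.
  - intros j x1 x2 x3 Hx. unfold u, u_ns_pp. rewrite !rot_grad_Derive. f_equal.
    apply Derive_ext. intros z. now apply phi_initial.
Qed.
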